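(* Let $P_2(n)$ be the number of payphone permutations of type (P2) and size $n$. Then for any integer $n\geq 1$, $$P_2(n) = \sum_{i=1}^n F\big(S'(i-1)\cup S'(n-i)\big),$$ where $$S'(\ell) := \begin{cases} \emptyset, & \text{if } \ell=0; \\ S(\ell-1) \cup \{2\ell-1\}, & \text{if } \ell\geq 1. \end{cases}$$
   Context: Multisets: $\#_k M$ denotes the multiplicity of $k$ in the multiset $M$, and $\cup$ denotes union of multisets with multiplicities added. For $n\ge 0$, the finite multiset $S(n)$ of positive integers is defined recursively by $S(0)=\emptyset$ and $$S(n)=\{n\}\cup S\left(\left\lfloor\tfrac{n-1}{2}\right\rfloor\right)\cup S\left(\left\lceil\tfrac{n-1}{2}\right\rceil\right)\quad (n\ge 1).$$ The function $F$ is defined on the finite multisets $M$ of positive integers by $$F(M) := \bigg(\prod_{k\geq 1} (\#_k M)!\bigg)\cdot 2^{\sum_{k\geq 1} \#_{2k} M}.$$ Type (P2) payphone permutations: $n$ payphones, labeled $1,\dots,n$, are arranged in a row; the distance between payphones $i$ and $j$ is $|i-j|$. Persons $1,2,\dots,n$ come one after another and each occupies an available payphone. The first person takes any payphone. Each subsequent person obeys the following rule (P2). An interval is a maximal sequence of available consecutive payphones; its length is the number of payphones in it. An interval is semi-closed or closed if it is flanked by $1$ or $2$ occupied payphones, respectively. The full length of a closed interval is its length; the full length of a semi-closed interval of length $\ell$ is $2\ell-1$. The person first selects any interval of greatest full length and then takes, within it, any payphone whose distance to its closest occupied payphone is as large as possible. The resulting assignment of people to payphones, $(p_1,\dots,p_n)$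 with $p_j$ the person occupying payphone $j$, is a payphone permutation of type (P2) and size $n$; $P_2(n)$ counts the distinct permutations of $\{1,\dots,n\}$ that can arise this way. *)

(* Defs.v *)
From mathcomp Require Import all_boot all_fingroup.
From mathcomp Require Import ssrint.
From mathcomp Require Export finmap multiset.

Set Implicit Arguments.
Unset Strict Implicit.
Unset Printing Implicit Defensive.

Local Open Scope nat_scope.
Local Open Scope mset_scope.

(* Multisets are finmap's {mset nat}: [M k] is the multiplicity of k in M, and
   `+` is the union in which multiplicities are added. *)

(* The first argument only bounds the recursion depth; see [multisetS0] and
   [multisetSE] for the defining equations.
   n.-1./2 = floor ((n-1)/2) and uphalf n.-1 = ceil ((n-1)/2). *)
Fixpoint multisetS_rec (fuel n : nat) : {mset nat} :=
  if fuel is fuel'.+1 then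
    if n == 0 then mset0
    else [mset n] `+` multisetS_rec fuel' n.-1./2
                  `+` multisetS_rec fuel' (uphalf n.-1)
  else mset0.

Definition multisetS (n : nat) : {mset nat} := multisetS_rec n n.

Lemma multisetS_recE fuel n : n <= fuel -> multisetS_rec fuel n = multisetS n.
Proof.
rewrite /multisetS.
have gen f1 : forall f2 m, m <= f1 -> m <= f2 ->
    multisetS_rec f1 m = multisetS_rec f2 m.
  elim: f1 => [|f1 IH] [|f2] [|m] //= le1 le2.
  rewrite !ltnS in le1 le2.
  have leh : m./2 <= m by rewrite -{2}(odd_double_half m) -addnn addnCA leq_addr.
  have leu : uphalf m <= m.
    by rewrite uphalf_half -{3}(odd_double_half m) leq_add2l -addnn leq_addr.
  by congr (_ `+` _ `+` _); apply: IH;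
     rewrite ?(leq_trans leh) ?(leq_trans leu).
by move=> le_n; apply: gen.
Qed.

Lemma multisetS0 : multisetS 0 = mset0.
Proof. by []. Qed.

Lemma multisetSE n : 1 <= n ->
  multisetS n =
    [mset n] `+` multisetS n.-1./2 `+` multisetS (uphalf n.-1).
Proof.
case: n => // n _; rewrite {1}/multisetS /= !multisetS_recE //.
  by rewrite uphalf_half -{3}(odd_double_half n) leq_add2l -addnn leq_addr.
by rewrite -{2}(odd_double_half n) -addnn addnCA leq_addr.
Qed.

Definition multisetS' (l : nat) : {mset nat} :=
  if l == 0 then mset0 else multisetS l.-1 `+` [mset l.*2.-1].

Definition mset_max (M : {mset nat}) : nat := \max_(k <- finsupp M) k.

(* The product and the sum over all k >= 1 are truncated at the largest element
   of M, beyond which all multiplicities vanish; by [payphoneF_bound] any larger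
   bound gives the same value. *)
Definition payphoneF (M : {mset nat}) : nat :=
  (\prod_(1 <= k < (mset_max M).+1) (M k)`!)
  * 2 ^ (\sum_(1 <= k < (mset_max M).+1) M k.*2).

Lemma mset_gt_max (M : {mset nat}) k : mset_max M < k -> M k = 0.
Proof.
move=> ltk; apply: fsfun_dflt; apply/negP => kM.
have lek : k <= mset_max M by apply: (leq_bigmax_seq k).
by rewrite ltnNge lek in ltk.
Qed.

Lemma payphoneF_bound (M : {mset nat}) (b : nat) : mset_max M <= b ->
  payphoneF M =
    (\prod_(1 <= k < b.+1) (M k)`!) * 2 ^ (\sum_(1 <= k < b.+1) M k.*2).
Proof.
move=> leb; rewrite /payphoneF; congr (_ * 2 ^ _).
  rewrite [RHS](@big_cat_nat _ _ _ (mset_max M).+1) //=.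
  rewrite [X in _ = _ * X]big1_seq ?muln1 // => k /=.
  by rewrite mem_index_iota => /andP[ltk _]; rewrite mset_gt_max.
rewrite [RHS](@big_cat_nat _ _ _ (mset_max M).+1) //=.
rewrite [X in _ = _ + X]big1_seq ?addn0 // => k /=.
rewrite mem_index_iota => /andP[ltk _]; apply: mset_gt_max.
by rewrite -addnn ltn_addr.
Qed.

(* Payphones and persons are both numbered from 0 to n-1 (instead of 1 to n). *)
Section Payphones.

Variable n : nat.
Implicit Types (A : {set 'I_n}) (a b x y : 'I_n).

(* In what follows A is the set of occupied payphones, and a pair (a, b) of
   payphones stands for the run of consecutive payphones a, a+1, .., b. *)

Definition in_run a b x : bool := a <= x <= b.

Definition flanks a b x : bool := (x.+1 == a) || (x == b.+1 :> nat).

Definition is_interval A a b : bool :=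
  [&& a <= b,
      [forall x, in_run a b x ==> (x \notin A)]
    & [forall x, flanks a b x ==> (x \in A)]].

Definition interval_length a b : nat := (b - a).+1.

Definition interval_closed A a b : bool := #|[set x in A | flanks a b x]| == 2.

(* An interval that is not closed is semi-closed as soon as A is nonempty, the
   only case in which the full length is used. *)
Definition full_length A a b : nat :=
  if interval_closed A a b then interval_length a b
  else (interval_length a b).*2.-1.

(* The distance from x to the closest payphone of A; the default n exceeds all
   distances, so it plays no role when A is nonempty. *)
Definition dist_occupied A x : nat :=
  \big[minn/n]_(y in A) `|(x : nat) - (y : nat)|%N.

Definition greatest_interval A a b : bool :=
  is_interval A a b &&
  [forall a', forall b',
     is_interval A a' b' ==> (full_length A a' b' <= full_length A a b)].

Definition P2_choice A x : bool :=
  [exists a, exists b,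
    [&& greatest_interval A a b, in_run a b x
      & [forall y, in_run a b y ==>
                     (dist_occupied A y <= dist_occupied A x)]]].

(* p j is the person who occupies payphone j, so that [set j | p j < p x] is
   the set of payphones already occupied when the occupant of x arrives; the
   first person, number 0, is unconstrained. *)
Definition P2_permutation (p : 'S_n) : bool :=
  [forall x, (0 < p x) ==> P2_choice [set j | p j < p x] x].

End Payphones.

Definition P2 (n : nat) : nat := #|[set p : 'S_n | P2_permutation p]|.

(* Main.v *)
(** Once the first person is seated, the occupied payphones cut the row into gaps.
    Attach to a closed gap of length l the multiset S(l), to a semi-closed one S'(l),
    and to a set of occupied payphones the sum M of the multisets of its gaps.  The
    largest element m of M is the greatest full length of an interval, and #_m M
    intervals attain it; each offers one best payphone if m is odd, two if m is even.
    Whichever payphone is taken, M merely loses one copy of m.  Since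
    F({m} + M') = #_m({m} + M') * (2 if m is even) * F(M'), the number of ways to
    seat the remaining persons satisfies the recurrence of F(M). *)

From HB Require Import structures.
Require Import Defs.
From mathcomp Require Import all_boot all_fingroup ssrint zify.
From mathcomp Require Import finmap multiset.

Set Implicit Arguments.
Unset Strict Implicit.
Unset Printing Implicit Defensive.

Local Open Scope nat_scope.
Local Open Scope mset_scope.

(** * Multiplicities in sums of multisets and the recurrence of [payphoneF] *)

HB.instance Definition _ :=
  Monoid.isComLaw.Build {mset nat} mset0 msetD (@msetDA _) (@msetDC _) (@mset0D _).

Lemma big_msetDE (I : finType) (P : pred I) (F : I -> {mset nat}) k :
  (\big[msetD/mset0]_(i | P i) F i) k = \sum_(i | P i) F i k.
Proof.
by apply: (big_morph (fun M : {mset nat} => M k)) => [M N|];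
  rewrite ?msetE2 ?mset0E.
Qed.

Lemma leq_mset_max (M : {mset nat}) b :
  (forall k, b < k -> M k = 0) -> mset_max M <= b.
Proof.
move=> Mb; apply/bigmax_leqP_seq => k kM _; rewrite leqNgt.
by apply/negP => /Mb /eqP; rewrite mset_eq0 -msuppE kM.
Qed.

Lemma payphoneF0 : payphoneF mset0 = 1.
Proof.
rewrite (@payphoneF_bound _ 0); first by rewrite !big_geq.
by apply: leq_mset_max => k _; rewrite mset0E.
Qed.

(** In the product only the factorial at [m] changes. In the exponent only the term [k = m./2] can
    grow, and it does so when [m] is even. *)
Lemma payphoneF_D1 m (M : {mset nat}) : 0 < m ->
  payphoneF ([mset m] `+` M) = (M m).+1 * 2 ^ (~~ odd m) * payphoneF M.
Proof.
(* A bound valid for both multisets makes both products and both sums run over the same indices. *)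
move=> m_gt0; set b := maxn m (mset_max M).
have le_mb : m <= b by rewrite leq_maxl.
have le_Mb : mset_max M <= b by rewrite leq_maxr.
have dE k : ([mset m] `+` M) k = (k == m) + M k by rewrite mset1DE.
rewrite (payphoneF_bound le_Mb) (@payphoneF_bound _ b); last first.
  apply: leq_mset_max => k ltbk; rewrite dE mset_gt_max; last lia.
  by rewrite addn0; lia.
have -> : \prod_(1 <= k < b.+1) (([mset m] `+` M) k)`! =
          (M m).+1 * \prod_(1 <= k < b.+1) (M k)`!.
  rewrite (bigD1_seq m) ?iota_uniq //=; last by rewrite mem_index_iota; lia.
  rewrite [in RHS](bigD1_seq m) ?iota_uniq //=; last by rewrite mem_index_iota; lia.
  rewrite dE eqxx add1n factS -!mulnA; congr (_ * (_ * _)).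
  by apply: eq_bigr => k /negPf; rewrite dE => ->.
have -> : \sum_(1 <= k < b.+1) ([mset m] `+` M) k.*2 =
          ~~ odd m + \sum_(1 <= k < b.+1) M k.*2.
  under eq_bigr do rewrite dE.
  rewrite big_split /=; congr (_ + _).
  have [odd_m|even_m] := boolP (odd m).
    by rewrite big1 // => k _; case: eqP odd_m => // <-; rewrite odd_double.
  rewrite (bigD1_seq m./2) ?iota_uniq //=; last by rewrite mem_index_iota; lia.
  rewrite big1 => [|k nk]; last by lia.
  by lia.
rewrite expnD; lia.
Qed.

Lemma multisetS_gt n k : n < k -> multisetS n k = 0.
Proof.
elim/ltn_ind: n => -[|n] IH lt_nk; first by rewrite multisetS0 mset0E.
rewrite multisetSE // !msetE2 msetnE IH ?IH; try lia.
by case: eqP; lia.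
Qed.

Lemma multisetS_diag n : 0 < n -> multisetS n n = 1.
Proof.
case: n => // n _; rewrite multisetSE // !msetE2 msetnxx /=.
by rewrite !multisetS_gt //; lia.
Qed.

Lemma multisetS'_gt l k : 0 < k -> l.*2.-1 < k -> multisetS' l k = 0.
Proof.
rewrite /multisetS'; case: l => [|l] _ lt_k; first by rewrite mset0E.
by rewrite msetE2 msetnE multisetS_gt /=; last lia; case: eqP; lia.
Qed.

Lemma multisetS'_diag l : 0 < l -> multisetS' l l.*2.-1 = 1.
Proof.
rewrite /multisetS'; case: l => [|l] _ //.
by rewrite msetE2 msetnxx multisetS_gt //=; lia.
Qed.

(** The default [d] acts as one more entry of the minimum. *)
Lemma leq_bigmin (I : Type) (r : seq I) (P : pred I) (F : I -> nat) d m :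
  (m <= \big[minn/d]_(i <- r | P i) F i) =
  (m <= d) && all (fun i => P i ==> (m <= F i)) r.
Proof.
elim: r => [|i r IH]; first by rewrite big_nil andbT.
by rewrite big_cons /=; case: (P i); rewrite // leq_min IH andbCA.
Qed.

(** * Gaps of a predicate on the natural numbers *)

Section Gaps.

Variable o : pred nat.

(** Empty gaps [v = u.+1] are kept: their multiset will be empty, and a newly occupied point then
    always splits a gap into exactly two. *)
Definition gap u v :=
  [&& u < v, o u, o v & all (predC o) (iota u.+1 (v - u.+1))].

Lemma gapP u v :
  reflect [/\ u < v, o u, o v & forall k, u < k < v -> ~~ o k] (gap u v).
Proof.
apply: (iffP and4P) => -[lt_uv ou ov no]; split=> //.
  by move=> k ltk; apply: (allP no); rewrite mem_iota; lia.
by apply/allP => k; rewrite mem_iota => ltk; apply: no; lia.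
Qed.

(** The ends of each gap are occupied, so they cannot be interior to the other gap; a common
    interior point [w] then forces equal ends. *)
Lemma gap_uniq u v u' v' w : gap u v -> gap u' v' ->
  u < w < v -> u' < w < v' -> u' = u /\ v' = v.
Proof.
move=> /gapP[_ ou ov no] /gapP[_ ou' ov' no'] w_uv w_uv'.
have := contraL (no u'); have := contraL (no v').
have := contraL (no' u); have := contraL (no' v).
by rewrite ou ov ou' ov' => /(_ isT) ? /(_ isT) ? /(_ isT) ? /(_ isT) ?; lia.
Qed.

Lemma gap_exists a b w : o a -> o b -> a < w < b -> ~~ o w ->
  exists u v, [/\ gap u v, a <= u, v <= b & u < w < v].
Proof.
move=> oa ob lt_awb now.
have exu : exists u, o u && (a <= u < w) by exists a; rewrite oa /=; lia.
have ubu u : o u && (a <= u < w) -> u <= w by lia.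
have exv : exists v, o v && (w < v <= b) by exists b; rewrite ob /=; lia.
case: (ex_maxnP exu ubu) => u /andP[ou ltu] umax.
case: (ex_minnP exv) => v /andP[ov ltv] vmin.
exists u, v; split; try lia.
apply/gapP; split=> //; first lia.
move=> k ltk; apply/negP => ok.
have [ltkw|ltwk|eqkw] := ltngtP k w.
- by have := umax k; rewrite ok /=; lia.
- by have := vmin k; rewrite ok /=; lia.
by move: now; rewrite -eqkw ok.
Qed.

End Gaps.

Lemma gap_insert (o o' : pred nat) u v w u' v' :
    (forall k, o' k = (k == w) || o k) -> gap o u v -> u < w < v ->
  gap o' u' v' = [|| gap o u' v' && ((u', v') != (u, v)),
                     (u', v') == (u, w) | (u', v') == (w, v)].
Proof.
move=> o'E guv w_uv; have /gapP[lt_uv ou ov no] := guv.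
apply/idP/or3P.
  move=> /gapP[lt_uv' ou' ov' no'].
  (* All of [u], [v], [w] satisfy [o'], so none is interior to [(u', v')]; it remains to ask whether
     [w] is one of its ends. *)
  have cu : ~~ (u' < u < v') by apply/negP => /no'; rewrite o'E ou orbT.
  have cv : ~~ (u' < v < v') by apply/negP => /no'; rewrite o'E ov orbT.
  have cw : ~~ (u' < w < v') by apply/negP => /no'; rewrite o'E eqxx.
  move: ou' ov'; rewrite !o'E !xpair_eqE.
  case: (eqVneq u' w) => [eq_u _|ne_u] /=.
    move/orP => [|ov']; first by lia.
    have := contraL (no v'); rewrite ov' => /(_ isT) ?.
    by apply: Or33; lia.
  move=> ou'; have := contraL (no u'); rewrite ou' => /(_ isT) cu'.
  case: (eqVneq v' w) => [eq_v _|ne_v] /=; first by apply: Or32; lia.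
  move=> ov'; apply: Or31; apply/andP; split; last lia.
  apply/gapP; split=> // k /no'; rewrite o'E; by case: (o k); rewrite ?orbT.
case=> [/andP[guv']|/eqP[-> ->]|/eqP[-> ->]].
- rewrite xpair_eqE => ne; have /gapP[lt_uv' ou' ov' no'] := guv'.
  apply/gapP; rewrite !o'E ou' ov' !orbT; split=> // k ltk.
  rewrite o'E negb_or no' // andbT; apply/eqP => eqk.
  have := gap_uniq guv guv' w_uv; rewrite -eqk => /(_ ltk); lia.
- apply/gapP; rewrite !o'E ou eqxx orbT; split=> //; first lia.
  by move=> k ltk; rewrite o'E negb_or no; lia.
- apply/gapP; rewrite !o'E ov eqxx orbT; split=> //; first lia.
  by move=> k ltk; rewrite o'E negb_or no; lia.
Qed.

(** * Full length, multiset and best positions of a single gap *)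

Section GapMultiset.

Variable n : nat.

(** The closed gaps: both ends are genuine payphones, not the sentinels [0] and [n.+1]. *)
Definition inner u v := (0 < u) && (v < n.+1).

Definition gap_full u v :=
  if inner u v then v - u.+1 else (v - u.+1).*2.-1.

Definition gap_mset u v :=
  if inner u v then multisetS (v - u.+1) else multisetS' (v - u.+1).

(** A sentinel is no payphone, so it only contributes [n], the default of [dist_occupied]. *)
Definition gap_dist u v x :=
  minn (if u == 0 then n else x - u) (if v == n.+1 then n else v - x).

(** The best points: the one or two midpoints of a closed gap, the end of the row in a semi-closed
    one. *)
Definition gap_choice u v x :=
  (u < x < v) && if inner u v then (x - u == (v - u)./2) || (v - x == (v - u)./2)
                 else x == if u == 0 then 1 else n.

Lemma gap_mset_gt u v k : 0 < k -> gap_full u v < k -> gap_mset u v k = 0.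
Proof.
rewrite /gap_full /gap_mset; case: ifP => _ k_gt0 ltk.
  exact: multisetS_gt.
exact: multisetS'_gt.
Qed.

Lemma gap_mset_full u v : 0 < gap_full u v -> gap_mset u v (gap_full u v) = 1.
Proof.
rewrite /gap_full /gap_mset; case: ifP => _ full_gt0.
  exact: multisetS_diag.
by apply: multisetS'_diag; lia.
Qed.

(** For a closed gap this is the recursion defining S, since a midpoint leaves the two halves. For a
    semi-closed gap of length l, the end of the row leaves an empty gap and a closed one of length l
    - 1, as in the definition of S'. *)
Lemma gap_mset_split u v x : (u, v) != (0, n.+1) -> v <= n.+1 ->
    gap_choice u v x ->
  gap_mset u v = [mset gap_full u v] `+` (gap_mset u x `+` gap_mset x v).
Proof.
rewrite xpair_eqE /gap_choice => ne_uv le_v /andP[/andP[lt_ux lt_xv]].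
rewrite /gap_mset /gap_full; have [inn|] := boolP (inner u v).
  have -> : inner u x by move: inn; rewrite /inner; lia.
  have -> : inner x v by move: inn; rewrite /inner; lia.
  move=> hx; rewrite multisetSE ?msetDA; last lia.
  (* The shorter half is on the left for the first kind of midpoint when the two differ, on the
     right for the second. *)
  case/orP: hx => /eqP hx; last rewrite [RHS]msetDAC.
    by congr (_ `+` multisetS _ `+` multisetS _); lia.
  by congr (_ `+` multisetS _ `+` multisetS _); lia.
rewrite /inner => inn /eqP xE; rewrite /multisetS'.
case: (eqVneq u 0) xE => [u0 x1|u0 xn].
  have -> : (0 < u) && (x < n.+1) = false by lia.
  have -> : (0 < x) && (v < n.+1) by lia.
  rewrite ifF; last lia.
  rewrite ifT; last lia.
  rewrite mset0D msetDC; congr (_ `+` multisetS _); lia.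
have -> : (0 < u) && (x < n.+1) by lia.
have -> : (0 < x) && (v < n.+1) = false by lia.
rewrite ifF; last lia.
rewrite ifT; last lia.
rewrite msetD0 msetDC; congr (_ `+` multisetS _); lia.
Qed.

Lemma gap_choice_max u v x : (u, v) != (0, n.+1) -> v <= n.+1 -> u < x < v ->
  reflect (forall y, u < y < v -> gap_dist u v y <= gap_dist u v x)
          (gap_choice u v x).
Proof.
rewrite xpair_eqE => ne_uv le_v x_uv; rewrite /gap_choice x_uv /=.
apply: (iffP idP) => [|max_x].
  rewrite /gap_dist /inner => xE y y_uv; move: xE.
  by do !case: ifP => ?; lia.
rewrite /inner; have [inn|inn] := boolP (_ && _).
  (* Comparison with one known best point is enough: a midpoint here, the end of the row below. *)
  have := max_x (u + (v - u)./2).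
  by rewrite /gap_dist; do !case: ifP => ?; lia.
have := max_x (if u == 0 then 1 else n).
by rewrite /gap_dist; do !case: ifP => ?; lia.
Qed.

(** The two midpoints of a closed gap coincide exactly when [v - u] is even, that is when its length
    [v - u.+1] is odd. A semi-closed gap has odd full length and a single best point. *)
Lemma card_gap_choice u v : (u, v) != (0, n.+1) -> u.+1 < v <= n.+1 ->
  #|[set x : 'I_n | gap_choice u v x.+1]| = 2 ^ (~~ odd (gap_full u v)).
Proof.
rewrite xpair_eqE => ne_uv lt_uv; rewrite /gap_full /gap_choice.
have [inn|inn] := boolP (inner u v).
  have lta : (u + (v - u)./2).-1 < n by move: inn; rewrite /inner; lia.
  have ltb : (v - (v - u)./2).-1 < n by move: inn; rewrite /inner; lia.
  rewrite (_ : [set x | _] = [set Ordinal lta; Ordinal ltb]); last first.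
    apply/setP => x; rewrite !inE -!val_eqE /=; move: inn; rewrite /inner.
    by case: x => x /= ltx; lia.
  rewrite cards2 -val_eqE /=; move: inn; rewrite /inner.
  by case: (boolP (odd _)) => ? ?; rewrite /= ?expn0 ?expn1; lia.
have lta : (if u == 0 then 0 else n.-1) < n.
  by move: inn; rewrite /inner; case: ifP; lia.
rewrite (_ : [set x | _] = [set Ordinal lta]).
  by rewrite cards1; case: (boolP (odd _)) => //; lia.
apply/setP => x; rewrite !inE -!val_eqE /=; move: inn; rewrite /inner.
by case: x => x /= ltx; do !case: ifP => ?; lia.
Qed.

End GapMultiset.

(** * Gaps of a set of occupied payphones, and the rule in terms of gaps *)

Section States.

Variable n : nat.
Implicit Types (A : {set 'I_n}) (x y : 'I_n) (p : 'I_n.+2 * 'I_n.+2).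

(* Payphone y is put at position y + 1 of 0..n+1, whose two end positions count as
   occupied; an interval (a, b) then becomes the gap (a, b + 2), and a gap is
   semi-closed when it has exactly one end among 0 and n + 1. *)
Definition occ A : pred nat :=
  fun k => [|| k == 0, k == n.+1 | [exists y in A, k == y.+1]].

Lemma occP A k :
  reflect [\/ k = 0, k = n.+1 | exists2 y, y \in A & k = y.+1] (occ A k).
Proof.
apply: (iffP or3P) => -[/eqP|/eqP|].
- exact: Or31.
- exact: Or32.
- by case/exists_inP => y Ay /eqP ky; apply: Or33; exists y.
- exact: Or31.
- exact: Or32.
by case=> y Ay ->; apply: Or33; apply/exists_inP; exists y.
Qed.

Lemma occ_ord A y : occ A y.+1 = (y \in A).
Proof.
apply/occP/idP => [[//||[z Az []]]|Ay]; last by apply: Or33; exists y.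
  by move=> []; have := ltn_ord y; lia.
by move/val_inj ->.
Qed.

Lemma occ_setU1 A x k : occ (x |: A) k = (k == x.+1) || occ A k.
Proof.
have -> : occ (x |: A) k =
    [|| k == 0, k == n.+1 | (k == x.+1) || [exists y in A, k == y.+1]].
  rewrite /occ; congr [|| _, _ | _].
  apply/exists_inP/orP => [[y] | [kx|/exists_inP[y Ay ky]]].
  - rewrite !inE => /orP[/eqP->|Ay] ky; [by left|right].
    by apply/exists_inP; exists y.
  - by exists x; rewrite // setU11.
  by exists y; rewrite // setU1r.
by rewrite /occ; do 3!case: (k == _).
Qed.

Definition occ_gap A : pred ('I_n.+2 * 'I_n.+2) := fun p => gap (occ A) p.1 p.2.

(** An occupied payphone would be interior to a gap joining the two sentinels. This provides the
    side condition of the lemmas on [gap_choice]. *)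
Lemma occ_gap_proper A p : A != set0 -> occ_gap A p ->
  (p.1 : nat, p.2 : nat) != (0, n.+1).
Proof.
case/set0Pn => y Ay /gapP[_ _ _ no]; apply/eqP => -[u0 vn].
have := no y.+1; rewrite occ_ord Ay u0 vn => /(_ _)/negP; apply=> //.
by have := ltn_ord y; lia.
Qed.

Lemma occ_gap_exists A x : x \notin A -> exists2 p, occ_gap A p & p.1 < x.+1 < p.2.
Proof.
move=> Ax; have ltx := ltn_ord x.
have [||||u [v [guv _ lev ltuv]]] := @gap_exists (occ A) 0 n.+1 x.+1.
- by apply/occP; apply: Or31.
- by apply/occP; apply: Or32.
- by lia.
- by rewrite occ_ord.
have ltu : u < n.+2 by lia.
by exists (Ordinal ltu, inord v); rewrite /occ_gap /= inordK.
Qed.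

Lemma occ_gap_uniq A p q k : occ_gap A p -> occ_gap A q ->
  p.1 < k < p.2 -> q.1 < k < q.2 -> p = q.
Proof.
move=> gp gq kp kq; have [] := gap_uniq gp gq kp kq.
case: p q {gp gq kp kq} => [u v] [u' v'] /= eu ev.
by congr pair; apply: val_inj.
Qed.

Lemma dist_occupiedE A x p : occ_gap A p -> p.1 < x.+1 < p.2 ->
  dist_occupied A x = gap_dist n p.1 p.2 x.+1.
Proof.
move=> /gapP[lt_uv ou ov no] x_uv.
(* Comparing lower bounds [m] turns both minima into conjunctions of inequalities. *)
have eqP_leq a b : (forall m, (m <= a) = (m <= b)) -> a = b.
  by move=> eq_ab; have := eq_ab a; have := eq_ab b; lia.
apply: eqP_leq => m; rewrite /dist_occupied /gap_dist leq_bigmin !leq_min.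
have ltx := ltn_ord x; have ltv := ltn_ord p.2.
apply/andP/andP => [[le_mn /allP le_m]|[le1 le2]].
  have {}le_m y : y \in A -> m <= `|(x : nat) - (y : nat)|%N.
    by apply/implyP/le_m; rewrite mem_index_enum.
  split.
    case: eqP ou => // u0 /occP[//|un|[y /le_m le_my uy]]; first lia.
    by rewrite uy; lia.
  case: eqP ov => // vn /occP[v0|//|[y /le_m le_my vy]]; first lia.
  by rewrite vy; lia.
have no_y (y : 'I_n) : y \in A -> y < p.1 \/ p.2 <= y.+1.
  move=> Ay; have := contraL (no y.+1); rewrite occ_ord => /(_ Ay); lia.
split; first by move: le1; case: ifP; lia.
apply/allP => y _; apply/implyP => /no_y.
have lty := ltn_ord y.
by move: le1 le2; do !case: ifP => ?; lia.
Qed.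

Lemma is_intervalE A (a b : 'I_n) :
  is_interval A a b = (a <= b) && gap (occ A) a b.+2.
Proof.
have lta := ltn_ord a; have ltb := ltn_ord b.
rewrite /is_interval; apply/and3P/andP => [[le_ab in_ab fl_ab]|[le_ab]].
  split=> //; apply/gapP; split; first lia.
  (* Position [a] is the left neighbour of payphone [a]: either the sentinel [0] or payphone
     [a.-1]. *)
  - case: (posnP a) => [->|a_gt0]; first by apply/occP; apply: Or31.
    have lt_pa : a.-1 < n by lia.
    have := forallP fl_ab (Ordinal lt_pa); rewrite /flanks /= prednK // eqxx /=.
    by rewrite -occ_ord /= prednK.
  - case: (ltnP b.+1 n) => [ltb1|leb1].
      have := forallP fl_ab (Ordinal ltb1); rewrite /flanks /= eqxx orbT /=.
      by rewrite -occ_ord.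
    by apply/occP; apply: Or32; lia.
  move=> k k_ab; have ltk : k.-1 < n by lia.
  have := forallP in_ab (Ordinal ltk); rewrite /in_run -occ_ord /= prednK; last lia.
  by move/implyP; apply; lia.
move=> /gapP[_ oa ob no]; split=> //; apply/forallP => x; apply/implyP.
  by rewrite /in_run -occ_ord => x_ab; apply: no; lia.
by rewrite /flanks -occ_ord => /orP[/eqP->|/eqP->].
Qed.

Lemma interval_closedE A (a b : 'I_n) : is_interval A a b ->
  interval_closed A a b = inner n a b.+2.
Proof.
have lta := ltn_ord a; have ltb := ltn_ord b.
case/and3P => le_ab _ /forallP fl_ab; rewrite /interval_closed /inner.
rewrite (_ : [set x in A | _] = [set x | flanks a b x]); last first.
  by apply/setP => x; rewrite !inE andb_idl // => /(implyP (fl_ab x)).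
apply/eqP/idP => [fl2|/andP[a_gt0 b_ltn]].
  have /set0Pn[x] : [set x | flanks a b x] != set0 by rewrite -cards_eq0 fl2.
  have : 0 < #|[set x | flanks a b x] :\ x| -> exists2 y, flanks a b y & y != x.
    by move=> /card_gt0P[y]; rewrite !inE => /andP[? ?]; exists y.
  move=> hy; rewrite inE => fx; have [] := hy.
    by have := cardsD1 x [set x | flanks a b x]; rewrite inE fx fl2; lia.
  move=> y fy; rewrite -val_eqE /=; move: fx fy; rewrite /flanks.
  by have := ltn_ord x; have := ltn_ord y; lia.
have lt_pa : a.-1 < n by lia.
have lt_sb : b.+1 < n by lia.
rewrite (_ : [set x | _] = [set Ordinal lt_pa; Ordinal lt_sb]).
  by rewrite cards2 -val_eqE /=; case: eqP => //=; lia.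
by apply/setP => x; rewrite !inE /flanks -!val_eqE /=; lia.
Qed.

Lemma full_lengthE A (a b : 'I_n) : is_interval A a b ->
  full_length A a b = gap_full n a b.+2.
Proof.
move=> int_ab; have /and3P[le_ab _ _] := int_ab.
rewrite /full_length interval_closedE // /gap_full /interval_length.
by case: ifP => _; rewrite subSS subSn.
Qed.

Definition max_full A := \max_(p | occ_gap A p) gap_full n p.1 p.2.

Lemma P2_choiceP A x : A != set0 ->
  reflect (exists p, [/\ occ_gap A p, gap_full n p.1 p.2 = max_full A
                       & gap_choice n p.1 p.2 x.+1])
          (P2_choice A x).
Proof.
move=> A0; rewrite /P2_choice.
have gapE (a b : 'I_n) : is_interval A a b ->
    exists2 p, occ_gap A p & p.1 = a :> nat /\ p.2 = b.+2 :> nat.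
  rewrite is_intervalE => /andP[_ gab]; have lta := ltn_ord a; have ltb := ltn_ord b.
  by exists (inord a, inord b.+2); rewrite /occ_gap /= !inordK //; lia.
have intE p : occ_gap A p -> p.1.+1 < p.2 ->
    exists a b : 'I_n, is_interval A a b /\ p.1 = a :> nat /\ p.2 = b.+2 :> nat.
  move=> gp ltp; have := ltn_ord p.2;
  case E : (nat_of_ord p.2) ltp => [|[|b]] // ltp ltb.
  have ltb' : b < n by lia.
  have lta' : p.1 < n by lia.
  exists (Ordinal lta'), (Ordinal ltb'); split=> //.
  by rewrite is_intervalE /= -E; apply/andP; split; first lia.
have maxE p : occ_gap A p -> gap_full n p.1 p.2 <= max_full A.
  by move=> gp; rewrite /max_full (bigD1 p) //= leq_maxl.
apply: (iffP existsP) => [[a /existsP[b /and3P[]]]|[p [gp fullp choicep]]].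
  move=> /andP[int_ab /forallP great] x_ab /forallP max_x.
  have [p gp [pa pb]] := gapE _ _ int_ab; exists p.
  have := int_ab; rewrite is_intervalE => /andP[le_ab _].
  have x_p : p.1 < x.+1 < p.2 by move: x_ab; rewrite pa pb /in_run; lia.
  split=> //.
    apply/eqP; rewrite eqn_leq maxE //=; apply/bigmax_leqP => q gq.
    (* Empty gaps correspond to no interval, but their full length is 0. *)
    case: (ltnP q.1.+1 q.2) => ltq; last first.
      have -> : gap_full n q.1 q.2 = 0 by rewrite /gap_full; case: ifP; lia.
      by [].
    have [a' [b' [int_ab' [qa qb]]]] := intE q gq ltq.
    have /forallP/(_ b')/implyP/(_ int_ab') := great a'.
    by rewrite !full_lengthE // pa pb qa qb.
  apply/gap_choice_max => //; first exact: occ_gap_proper gp.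
    by rewrite -ltnS.
  move=> y y_p; have lty : y.-1 < n by have := ltn_ord p.2; lia.
  have := max_x (Ordinal lty); rewrite !(dist_occupiedE gp) //= prednK; try lia.
  by move/implyP; apply; rewrite /in_run /=; lia.
have x_p : p.1 < x.+1 < p.2 by case/andP: choicep.
have [|a [b [int_ab [pa pb]]]] := intE p gp; first lia.
exists a; apply/existsP; exists b; apply/and3P; split.
- rewrite /greatest_interval int_ab /=; apply/forallP => a'; apply/forallP => b'.
  apply/implyP => int_ab'; have [q gq [qa qb]] := gapE _ _ int_ab'.
  by rewrite !full_lengthE // -pa -pb -qa -qb fullp maxE.
- by rewrite /in_run; lia.
apply/forallP => y; apply/implyP => y_ab.
have y_p : p.1 < y.+1 < p.2 by move: y_ab; rewrite pa pb /in_run; lia.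
rewrite !(dist_occupiedE gp) //.
move/gap_choice_max: choicep; apply=> //; first exact: occ_gap_proper gp.
by rewrite -ltnS.
Qed.

Definition state_mset A : {mset nat} :=
  \big[msetD/mset0]_(p | occ_gap A p) gap_mset n p.1 p.2.

(** A gap of greatest full length contributes that number exactly once; every other gap has only
    smaller elements. *)
Lemma state_mset_max A : 0 < max_full A ->
  state_mset A (max_full A) =
    #|[set p | occ_gap A p && (gap_full n p.1 p.2 == max_full A)]|.
Proof.
move=> max_gt0; rewrite /state_mset big_msetDE -sum1dep_card [RHS]big_mkcondr /=.
apply: eq_bigr => p gp.
case: eqP => [full_max|full_max].
  by rewrite -full_max gap_mset_full // full_max.
apply: gap_mset_gt => //; rewrite ltn_neqAle; apply/andP; split; first exact/eqP.
by rewrite /max_full (bigD1 p) //= leq_maxl.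
Qed.

Lemma card_P2_choice A : A != set0 -> 0 < max_full A ->
  #|[set x | P2_choice A x]| = state_mset A (max_full A) * 2 ^ (~~ odd (max_full A)).
Proof.
move=> A0 max_gt0; rewrite state_mset_max //.
set G := [set p | occ_gap A p && _]; rewrite -sum_nat_const.
have gc p : p \in G ->
    #|[set x : 'I_n | gap_choice n p.1 p.2 x.+1]| = 2 ^ (~~ odd (max_full A)).
  rewrite inE => /andP[gp /eqP fp]; rewrite -fp; apply: card_gap_choice.
    exact: occ_gap_proper gp.
  rewrite -[_ <= n.+1]ltnS ltn_ord andbT; move: max_gt0; rewrite -fp /gap_full.
  by rewrite -[_.+1 < _]subn_gt0; case: ifP => _ //; case: (_ - _).
(* Double counting of the pairs of a greatest gap and a best point in it: each admissible payphone
   lies in exactly one such gap. *)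
rewrite -(eq_bigr _ gc) -sum1_card; under [RHS]eq_bigr do rewrite -sum1_card.
rewrite (exchange_big_dep (mem [set x | P2_choice A x])) /=; last first.
  move=> p x; rewrite !inE => /andP[gp /eqP fp] cp.
  by apply/P2_choiceP => //; exists p.
apply: eq_bigr => x; rewrite inE => /(P2_choiceP _ A0)[p [gp fp cp]].
rewrite (bigD1 p) /=; last by rewrite !inE gp fp eqxx.
rewrite big1 // => q; rewrite !inE => /andP[/andP[/andP[gq _] cq]] /eqP[].
by case/andP: cp cq => xp _ /andP[xq _]; apply: occ_gap_uniq gq gp xq xp.
Qed.

End States.

(** * Effect of one choice on the multiset of gaps *)

Section Count.

Variable n : nat.
Implicit Types (A : {set 'I_n}) (x y : 'I_n) (p q : 'S_n).

Lemma P2_choice_notin A x : A != set0 -> P2_choice A x -> x \notin A.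
Proof.
move=> A0 /(P2_choiceP _ A0)[p [/gapP[_ _ _ no] _ /andP[/no x_p _]]].
by rewrite -occ_ord.
Qed.

Lemma max_full_gt0 A x : x \notin A -> 0 < max_full A.
Proof.
move=> /occ_gap_exists[p gp x_p]; rewrite /max_full (bigD1 p) //= leq_max.
have : 0 < p.2 - p.1.+1 by rewrite subn_gt0; lia.
by rewrite /gap_full; case: ifP => _; case: (_ - _).
Qed.

Lemma state_mset_setU1 A x (g : 'I_n.+2 * 'I_n.+2) :
    occ_gap A g -> g.1 < x.+1 < g.2 ->
  state_mset (x |: A) =
    gap_mset n g.1 x.+1 `+` gap_mset n x.+1 g.2
    `+` \big[msetD/mset0]_(h | occ_gap A h && (h != g)) gap_mset n h.1 h.2.
Proof.
move=> gg x_g; have ltx : x.+1 < n.+2 by have := ltn_ord x; lia.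
pose w : 'I_n.+2 := Ordinal ltx.
(* The point [w] is free in [A], so no old gap ends there; the two new gaps are therefore distinct
   from the old ones. *)
have gap_w h : occ_gap A h -> h != g ->
    (h == (g.1, w)) = false /\ (h == (w, g.2)) = false.
  move=> /gapP[_ o1 o2 no] ne_h; have /gapP[_ _ _ nog] := gg.
  have now : ~~ occ A w by apply: nog.
  by split; apply: contraNF now => /eqP eq_h; rewrite ?eq_h // in o1 o2 *.
have gapE h : occ_gap (x |: A) h =
    [|| occ_gap A h && (h != g), h == (g.1, w) | h == (w, g.2)].
  rewrite /occ_gap (gap_insert _ _ (occ_setU1 A x) gg x_g).
  by case: h {gap_w} g {gg x_g} => [u v] [u' v'].
rewrite /state_mset (bigD1 (g.1, w)) ?gapE ?eqxx ?orbT //=.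
rewrite (bigD1 (w, g.2)) ?gapE ?eqxx ?orbT //=; last first.
  by rewrite xpair_eqE -!val_eqE /=; lia.
rewrite msetDA; congr (_ `+` _ `+` _); apply: eq_bigl => h; rewrite gapE.
have [gh|] := boolP (occ_gap A h && (h != g)).
  by case/andP: gh => gh ne_h; have [-> ->] := gap_w h gh ne_h.
by move=> _; case: (h == (g.1, w)); case: (h == (w, g.2)).
Qed.

(** Only the gap containing [x] changes, and [gap_mset_split] says that it gives up one copy of its
    full length. *)
Lemma state_mset_choice A x : A != set0 -> P2_choice A x ->
  state_mset A = max_full A +` state_mset (x |: A).
Proof.
move=> A0 /(P2_choiceP _ A0)[g [gg fg cg]]; have /andP[x_g _] := cg.
rewrite (state_mset_setU1 gg x_g) /state_mset (bigD1 g) //= msetDA; congr (_ `+` _).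
rewrite -fg (gap_mset_split _ _ cg) //; first exact: occ_gap_proper gg.
by rewrite -ltnS.
Qed.

Lemma state_mset1 x : state_mset [set x] = multisetS' x `+` multisetS' (n - x.+1).
Proof.
have lt0 : 0 < n.+2 by []. have ltn1 : n.+1 < n.+2 by [].
have ltx := ltn_ord x.
have occ0 k : occ (set0 : {set 'I_n}) k = (k == 0) || (k == n.+1).
  by apply/occP/orP => [[->|->|[y]]|[/eqP->|/eqP->]]; rewrite ?inE ?eqxx;
     [left|right| |apply: Or31|apply: Or32].
(* Before anyone arrives the only gap joins the two sentinels; payphone [x] splits it into two
   semi-closed gaps. *)
have g0 : occ_gap (set0 : {set 'I_n}) (Ordinal lt0, Ordinal ltn1).
  by apply/gapP; rewrite !occ0 /= eqxx; split=> // k; rewrite occ0; lia.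
rewrite -[[set x]]setU0 (state_mset_setU1 g0) /=; last lia.
rewrite big1 ?msetD0 /gap_mset /inner /=.
  by rewrite ltnn subn1 subSS.
move=> h /andP[/gapP[lt_uv]]; rewrite !occ0 => o1 o2 _.
have := ltn_ord h.2; case: h lt_uv o1 o2 => u v /= ? ? ? ? /eqP[].
by congr pair; apply: val_inj => /=; lia.
Qed.

Lemma state_msetT : state_mset [set: 'I_n] = mset0.
Proof.
rewrite /state_mset big1 // => g /gapP[lt_uv _ _ no].
have eq0 : g.2 - g.1.+1 = 0.
  apply/eqP; rewrite subn_eq0 leqNgt; apply/negP => lt_uv'.
  have ltg : g.1 < n by have := ltn_ord g.2; lia.
  by have := no g.1.+1; rewrite (occ_ord _ (Ordinal ltg)) inE ltnSn lt_uv';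
     move/(_ isT).
by rewrite /gap_mset eq0; case: ifP.
Qed.

(** All summands are equal, and their number, given by [card_P2_choice], is the factor appearing in
    [payphoneF_D1]. *)
Lemma payphoneF_state A : A != set0 -> A != setT ->
  \sum_(x | P2_choice A x) payphoneF (state_mset (x |: A)) =
  payphoneF (state_mset A).
Proof.
move=> A0; rewrite -subTset => /subsetPn[x0 _ Ax0].
have max_gt0 := max_full_gt0 Ax0.
set N := state_mset A; set m := max_full A in max_gt0 *.
transitivity (\sum_(x | P2_choice A x) payphoneF (N `\ m)).
  by apply: eq_bigr => x cx; rewrite /N (state_mset_choice A0 cx) msetD1K.
(* The maximum [m] is attained by some gap, which contributes a copy of it. *)
have mN : m \in N.
  rewrite -mset_gt0 state_mset_max //; apply/card_gt0P.
  have [g gg _] := occ_gap_exists Ax0.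
  have [|h gh mh] := @eq_bigmax_cond _ (occ_gap A) (fun h => gap_full n h.1 h.2).
    by apply/card_gt0P; exists g.
  exists h; rewrite inE; apply/andP; split; first exact: gh.
  by rewrite /m /max_full mh /=.
rewrite -{2}(msetB1K mN) payphoneF_D1 // msetB1E eqxx subn1 prednK ?mset_gt0 //.
rewrite -card_P2_choice // -sum1dep_card big_distrl /=.
by under [RHS]eq_bigr do rewrite mul1n.
Qed.

(** * Counting the permutations that extend a partial seating *)

Definition P2_from j p :=
  [forall x, (j <= p x) ==> P2_choice [set y | p y < p x] x].

(** A seating of the persons below [j] is encoded by any permutation [q] that extends it; only the
    values of [q] below [j] matter. *)
Definition agree_below j q p := [forall x, (q x < j) ==> (p x == q x)].

Lemma agree_below_set j q p : agree_below j q p ->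
  [set y | p y < j] = [set y | q y < j].
Proof.
move=> /forallP pq; have eq_pq x : q x < j -> p x = q x by move/(implyP (pq x))/eqP.
apply/setP => y; rewrite !inE; apply/idP/idP => [lt_pj|lt_qj]; last by rewrite eq_pq.
have := eq_pq (q^-1 (p y))%g; rewrite permKV => /(_ lt_pj)/perm_inj <-.
by rewrite permKV.
Qed.

(** Exchanging the persons [q x] and [j], both at least [j], keeps the partial seating and puts
    person [j] at [x]. *)
Lemma agree_belowS (j : 'I_n) q p x : j <= q x ->
  agree_below j.+1 (q * tperm (q x) j)%g p =
  agree_below j q p && ((p^-1)%g j == x).
Proof.
move=> le_jq; have q'E y : (q * tperm (q x) j)%g y = tperm (q x) j (q y).
  by rewrite permM.
apply/forallP/andP => [pq|[/forallP pq /eqP px] y].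
  have px : p x = j.
    by have := pq x; rewrite q'E tpermL ltnSn => /eqP.
  split; last by rewrite -px permK.
  apply/forallP => y; apply/implyP => lt_qj.
  have := pq y; rewrite q'E tpermD; first by rewrite ltnS ltnW.
    by apply: contraTneq lt_qj => <-; rewrite -leqNgt.
  by apply: contraTneq lt_qj => <-; rewrite ltnn.
rewrite q'E; case: tpermP => [/perm_inj->|qy|ne1 ne2].
- by rewrite -px permKV eqxx implybT.
- apply/implyP; rewrite ltnS => le_qj.
  have /eqP : q x = j :> nat by apply/eqP; rewrite eqn_leq le_qj le_jq.
  rewrite val_eqE -{1}qy => /eqP/perm_inj eq_xy.
  by rewrite -eq_xy in qy *; rewrite qy -px permKV.
apply/implyP; rewrite ltnS leq_eqVlt => /orP[/eqP/val_inj//|].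
exact: (implyP (pq y)).
Qed.

Lemma below_tperm (j : 'I_n) q x : j <= q x ->
  [set y | (q * tperm (q x) j)%g y < j.+1] = x |: [set y | q y < j].
Proof.
move=> le_jq; apply/setP => y; rewrite !inE permM.
case: tpermP => [/perm_inj->|qy|ne1 ne2]; first by rewrite eqxx ltnSn.
  rewrite qy ltnn orbF ltnS; apply/idP/eqP => [le_qj|eq_yx];
    last by rewrite -eq_yx qy.
  apply: (@perm_inj _ q); apply: val_inj; rewrite qy.
  by apply/eqP; rewrite eqn_leq le_jq le_qj.
have -> : (y == x) = false by apply/eqP => eq_yx; rewrite eq_yx in ne1.
by rewrite ltnS leq_eqVlt; case: eqP => // /val_inj.
Qed.

Lemma card_P2_from j q : 0 < j <= n ->
  #|[set p | agree_below j q p && P2_from j p]| =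
  payphoneF (state_mset [set x | q x < j]).
Proof.
(* Induction on the number of persons still to be seated; [q] varies, since each step extends the
   partial seating. *)
move: {2}(n - j) (erefl (n - j)) => d; elim: d j q => [|d IH] j q eq_d j_n.
  have -> : j = n by lia.
  rewrite [in RHS](_ : [set x | _] = setT) ?state_msetT ?payphoneF0; last first.
    by apply/setP => x; rewrite !inE ltn_ord.
  rewrite (_ : [set p | _] = [set q]) ?cards1 //; apply/setP => p; rewrite !inE.
  apply/andP/eqP => [[/forallP pq _]|->].
    by apply/permP => x; have := pq x; rewrite ltn_ord => /eqP.
  by split; apply/forallP => x; rewrite ?eqxx ?implybT // leqNgt ltn_ord.
have ltjn : j < n by lia.
pose J := Ordinal ltjn; set A := [set x | q x < j].
have lt0n : 0 < n by lia.
have A0 : A != set0.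
  by apply/set0Pn; exists ((q^-1)%g (Ordinal lt0n)); rewrite inE permKV /=; lia.
have AT : A != setT.
  rewrite -subTset; apply/subsetPn; exists ((q^-1)%g J) => //.
  by rewrite inE permKV /= ltnn.
rewrite -payphoneF_state // -sum1dep_card.
(* The permutations are sorted by the payphone of person [j], which must be an admissible choice for
   [A]. *)
rewrite (partition_big (fun p : 'S_n => (p^-1)%g J) (P2_choice A)) /=; last first.
  move=> p /andP[pq /forallP/(_ ((p^-1)%g J))].
  by rewrite permKV leqnn /= (agree_below_set pq).
apply: eq_bigr => x cx.
have le_jq : J <= q x by have := P2_choice_notin A0 cx; rewrite inE -leqNgt.
rewrite -(below_tperm le_jq) -IH /=; try lia.
rewrite sum1dep_card; apply: eq_card => p; rewrite !inE (agree_belowS _ le_jq).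
rewrite -!andbA; have [pq|//] := boolP (agree_below _ _ _); rewrite /= andbC.
case: eqP => //= px; apply/forallP/forallP => pP y; apply/implyP => le_jp.
  by apply: (implyP (pP y)); rewrite ltnW.
(* Only the rule for person [j] is left to check; that person sits at [x], where it is the
   hypothesis [cx]. *)
have := implyP (pP y); move: le_jp; rewrite leq_eqVlt.
case/orP=> [/eqP eq_jp|lt_jp]; last exact.
have -> : y = x.
  by rewrite -px; apply: (@perm_inj _ p); rewrite permKV; apply: val_inj.
have -> : p x = J by rewrite -px permKV.
by rewrite (agree_below_set pq).
Qed.

End Count.

Theorem theorem4 (n : nat) (hn : 1 <= n) :
  P2 n = \sum_(1 <= i < n.+1) payphoneF (multisetS' (i - 1) `+` multisetS' (n - i)).
Proof.
case: n hn => // n _; rewrite big_add1 big_mkord /P2 -sum1dep_card.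
(* The sum runs over the payphone [x] of the first person, with [i = x + 1]. *)
rewrite (partition_big (fun p : 'S_n.+1 => (p^-1)%g ord0) predT) //=.
apply: eq_bigr => x _; rewrite subn1 /= -state_mset1.
(* The empty seating may be encoded by the identity; the transposition then seats person 0 at
   [x]. *)
have le0 : (ord0 : 'I_n.+1) <= (1%g : 'S_n.+1) x by [].
have := below_tperm le0; rewrite (_ : [set y | _ < ord0] = set0) ?setU0; last first.
  by apply/setP => y; rewrite !inE.
(* With person 0 seated, [P2_permutation] is [P2_from 1] by conversion. *)
move=> <-; rewrite -card_P2_from // sum1dep_card.
apply: eq_card => p; rewrite !inE (agree_belowS _ le0) andbC; congr (_ && _).
by rewrite (_ : agree_below _ _ _) //; apply/forallP.
Qed.
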